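(* Let $f\in\mathbb{Q}[x]$ be an irreducible polynomial of degree four with distinct roots $x_1,x_2,x_3,x_4$, let $L=\mathbb{Q}(x_1,x_2,x_3,x_4)$, and let $a,b,c,d$ be integers such that the $24$ values $V_\sigma = a x_{\sigma(1)}+b x_{\sigma(2)}+c x_{\sigma(3)}+d x_{\sigma(4)}$ $(\sigma\in S_4)$ are pairwise distinct. Put $V_1=ax_1+bx_2+cx_3+dx_4$ and let $g\in\mathbb{Q}[x]$ be the minimal polynomial of $V_1$ over $\mathbb{Q}$. Then the substitutions that are automorphisms are precisely the substitutions belonging to the Galois group; that is, for $\sigma\in S_4$, the substitution $x_s\mapsto x_{\sigma(s)}$ $(s=1,2,3,4)$ is an automorphism of $L$ if and only if $V_\sigma$ is a root of $g$.
   Context: A substitution is a permutation $\sigma\in S_4$ of the roots, replacing $x_s$ by $x_{\sigma(s)}$ for $s=1,2,3,4$. It is called an automorphism (of $L$) if it induces a field automorphism of $L$, i.e. if the rule $\delta(x_1,x_2,x_3,x_4)\mapsto\delta(x_{\sigma(1)},x_{\sigma(2)},x_{\sigma(3)},x_{\sigma(4)})$ for $\delta\in\mathbb{Q}[X_1,X_2,X_3,X_4]$ is a well-defined field automorphism of $L$. The Galois group (in the sense of Galois' Proposition I) is the set of substitutions $\begin{pmatrix}V_1\\ V_\sigma\end{pmatrix}$, meaning the substitutions $x_s\mapsto x_{\sigma(s)}$ that turn the expression $V_1$ into $V_\sigma$, where $V_\sigma$ runs through the roots of the minimal polynomial $g$ of $V_1$ over $\mathbb{Q}$. *)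

(* Defs.v *)
From HB Require Import structures.
From mathcomp Require Import all_boot all_order all_algebra all_fingroup all_field.
From mathcomp Require Import mpoly.

Set Implicit Arguments.
Unset Strict Implicit.
Unset Printing Implicit Defensive.

Import GRing.Theory.
Local Open Scope ring_scope.

(* The roots are indexed by 'I_4 = {0, 1, 2, 3} instead of {1, 2, 3, 4}. *)

Definition V (L : fieldExtType rat) (x : 'I_4 -> L) (a b c d : int)
    (sigma : 'S_4) : L :=
  a%:~R * x (sigma 0) + b%:~R * x (sigma 1)
  + c%:~R * x (sigma 2) + d%:~R * x (sigma 3).

(* The rule delta(x) |-> delta(x \o sigma) is a well-defined map on L when some
   function phi on L obeys it for every delta; it is defined on all of L because
   Q(x_1, .., x_4) = Q[x_1, .., x_4] for algebraic x_i. *)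
Definition is_automorphism (L : fieldExtType rat) (x : 'I_4 -> L)
    (sigma : 'S_4) : Prop :=
  exists phi : {rmorphism L -> L},
    bijective phi
    /\ forall delta : {mpoly rat[4]},
         phi (map_mpoly (in_alg L) delta).@[x]
         = (map_mpoly (in_alg L) delta).@[x \o sigma].

(* Galois' Proposition I: g is meant to be the minimal polynomial of V_1 over Q,
   and the substitution sigma turns the expression V_1 into V_sigma. *)
Definition galois_group (L : fieldExtType rat) (x : 'I_4 -> L)
    (a b c d : int) (g : {poly rat}) : {set 'S_4} :=
  [set sigma | root (map_poly (in_alg L) g) (V x a b c d sigma)].

(* Main.v *)
Require Import Defs.
From HB Require Import structures.
From mathcomp Require Import all_boot all_order all_algebra all_fingroup all_field.
From mathcomp Require Import mpoly.

Set Implicit Arguments.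
Unset Strict Implicit.
Unset Printing Implicit Defensive.

Import GRing.Theory.
Local Open Scope ring_scope.

(* An automorphism attached to sigma fixes Q and sends V_1, a linear expression in
   the roots, to V_sigma, which is therefore a root of g.  Conversely, if V_sigma
   is a root of g, then V_1 |-> V_sigma defines an embedding of Q(V_1), which
   extends to the splitting field L and permutes the roots of f by some tau; then
   V_tau = V_sigma, and distinctness of the V's forces tau = sigma. *)

(** This is what upgrades a known action on the four roots to the substitution rule for every
    [delta]. *)
Lemma rmorph_meval_in_alg (F : fieldType) (L : fieldExtType F) (n : nat)
    (phi : {rmorphism L -> L}) (x : 'I_n -> L) (p : {mpoly F[n]}) :
    (forall k, phi (in_alg L k) = in_alg L k) ->
  phi (map_mpoly (in_alg L) p).@[x] = (map_mpoly (in_alg L) p).@[phi \o x].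
Proof.
move=> phi_id; elim/mpolyind: p => [|k m p _ _ IHp].
  by rewrite rmorph0 !meval0 rmorph0.
rewrite rmorphD /= !mevalD rmorphD IHp; congr (_ + _).
rewrite map_mpolyZ map_mpolyX !mevalZ !mevalX rmorphM phi_id rmorph_prod.
by congr (_ * _); apply: eq_bigr => i _; rewrite rmorphXn.
Qed.

(** A polynomial of degree [n] has no room for a root besides the [n] distinct [x s], so [h] maps
    this finite set injectively into itself. *)
Lemma permutes_roots (R : idomainType) (n : nat) (p : {poly R}) (x : 'I_n -> R)
    (h : R -> R) :
    size p = n.+1 -> injective x -> (forall s, root p (x s)) ->
    injective h -> {homo h : y / root p y} ->
  exists tau : 'S_n, forall s, h (x s) = x (tau s).
Proof.
move=> sz_p inj_x x_root inj_h root_h.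
have root_codom y : root p y -> y \in codom x.
  apply: contraLR => x'y; apply/negP => root_y.
  (* A root outside [codom x] would make [n.+1] distinct roots, while their number must stay below
     [size p = n.+1]. *)
  have := @max_poly_roots _ p (y :: codom x).
  rewrite -size_poly_eq0 /= x'y sz_p size_codom card_ord ltnn root_y.
  have -> : uniq (codom x) by apply/injectiveP.
  have -> : all (root p) (codom x) by apply/allP=> _ /codomP[s ->].
  by move=> /(_ isT isT isT).
have h_x s : h (x s) \in codom x by apply/root_codom/root_h.
have inj_tau : injective (fun s => iinv (h_x s)).
  move=> s t /(congr1 x); rewrite !f_iinv => /inj_h.
  exact: inj_x.
by exists (perm inj_tau) => s; rewrite permE f_iinv.
Qed.

(** The kernel is trivial because [L] is a field; finite dimension then makes the linear inverse
    two-sided. *)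
Lemma aend_bij (F : fieldType) (L : fieldExtType F) (h : 'AEnd(L)) :
  bijective h.
Proof.
have h0 := kAutf_lker0 (k1AHom fullv h).
by exists (h^-1)%VF; [apply: lker0_lfunK | apply: lker0_lfunVK].
Qed.

Lemma splittingFieldFor_roots (F : fieldType) (L : fieldExtType F) (n : nat)
    (p : {poly L}) (x : 'I_n -> L) :
    size p = n.+1 -> injective x -> (forall s, root p (x s)) ->
  splittingFieldFor 1 p <<1 & codom x>>.
Proof.
move=> sz_p inj_x x_root; exists (codom x) => //.
rewrite [p in p %= _](@all_roots_prod_XsubC _ p (codom x)).
- by apply: eqp_scale; rewrite lead_coef_eq0 -size_poly_eq0 sz_p.
- by rewrite sz_p size_codom card_ord.
- by apply/allP=> _ /codomP[s ->].
- by rewrite uniq_rootsE; apply/injectiveP.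
Qed.

Lemma aend_minPoly_root (F : fieldType) (L : fieldExtType F) (p : {poly L})
    (u v : L) :
    p \is a polyOver 1%VS -> splittingFieldFor 1 p {:L} ->
    root (minPoly 1 u) v ->
  exists h : 'AEnd(L), h u = v.
Proof.
move=> p_over splits_p min_v.
(* The extension to [<<1; u>>] starts from the identity of the base field, which leaves the
   coefficients of the minimal polynomial unchanged. *)
have min_v1 : root (map_poly \1%VF (minPoly 1 u)) v.
  by rewrite (kHom_poly_id (kHom1 1 1)) ?minPolyOver.
have hom_u := kHomExtendP (subvv 1%AS) (kHom1 1 1) min_v1.
(* [L] remains a splitting field of [p] over the larger base [<<1; u>>], so the embedding extends
   once more, to all of [L]. *)
have splits_u := splittingFieldForS (sub1v <<1; u>>%AS) (subvf _) splits_p.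
have [h hom_h eq_h] := kHom_extends (sub1v _) hom_u p_over splits_u.
rewrite k1HomE in hom_h; exists (AHom hom_h) => /=.
by rewrite -eq_h ?memv_adjoin // (kHomExtend_val (kHom1 1 1) min_v1).
Qed.

Lemma rmorph_V (L : fieldExtType rat) (x : 'I_4 -> L) (a b c d : int)
    (phi : {rmorphism L -> L}) (tau : 'S_4) :
    (forall s, phi (x s) = x (tau s)) ->
  phi (V x a b c d 1%g) = V x a b c d tau.
Proof.
by move=> phi_x; rewrite /V !rmorphD !rmorphM !rmorph_int /= !perm1 !phi_x.
Qed.

Theorem proposition3 (f : {poly rat})
  (f_irr : irreducible_poly f) (f_deg4 : size f = 5%N)
  (L : fieldExtType rat) (x : 'I_4 -> L)
  (x_distinct : injective x)
  (x_roots : forall s : 'I_4, root (map_poly (in_alg L) f) (x s))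
  (L_gen : <<1 & [seq x s | s : 'I_4]>>%VS = fullv)
  (a b c d : int)
  (V_distinct : injective (V x a b c d))
  (g : {poly rat})
  (g_min : map_poly (in_alg L) g = minPoly 1%AS (V x a b c d 1%g))
  (sigma : 'S_4) :
  is_automorphism x sigma <-> sigma \in galois_group x a b c d g.
Proof.
pose fL := map_poly (in_alg L) f.
(* Used in both directions: with [g] for the direct one, with [f] for the converse. *)
have root_rmorph (phi : {rmorphism L -> L}) (p : {poly rat}) :
    (forall k, phi (in_alg L k) = in_alg L k) ->
  {homo phi : y / root (map_poly (in_alg L) p) y}.
  move=> phi_id y /(rmorph_root phi); rewrite -map_poly_comp.
  by rewrite (eq_map_poly (phi_id : _ =1 in_alg L)).
rewrite inE; split=> [[phi [_ phi_delta]] | root_sigma].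
  (* Constant polynomials [delta] show that [phi] fixes the rationals, and the variables ['X_s] give
     its action on the roots. *)
  have phi_id k : phi (in_alg L k) = in_alg L k.
    by have := phi_delta k%:MP; rewrite map_mpolyC !mevalC.
  have phi_x s : phi (x s) = x (sigma s).
    by have := phi_delta 'X_s; rewrite map_mpolyX !mevalXU.
  rewrite -(rmorph_V a b c d phi_x).
  by apply: root_rmorph => //; rewrite g_min root_minPoly.
have sz_f : size fL = 5%N by rewrite size_map_poly.
have splits_f := splittingFieldFor_roots sz_f x_distinct x_roots.
rewrite /codom /image_mem L_gen in splits_f.
rewrite g_min in root_sigma.
have f_over : fL \is a polyOver 1%VS by apply/polyOver1P; exists f.
have [h hV] := aend_minPoly_root f_over splits_f root_sigma.
have h_id k : h (in_alg L k) = in_alg L k by rewrite linearZ rmorph1.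
have [tau h_x] := permutes_roots sz_f x_distinct x_roots (bij_inj (aend_bij h))
                    (root_rmorph h f h_id).
have tau_sigma : tau = sigma.
  by apply: V_distinct; rewrite -(rmorph_V a b c d h_x).
exists h; split=> [|delta]; first exact: aend_bij.
rewrite rmorph_meval_in_alg //; apply: meval_eq => s.
by rewrite /= h_x tau_sigma.
Qed.
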